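(* Consider the unidimensional game of the context, hold voter shares fixed, and follow the equilibrium in which party $A$ offers the right platform $\bar x(\mathbf x,\mathbf s)$ and party $B$ offers the left platform $\underline x(\mathbf x,\mathbf s)$. Let $x_m$ be the median. For every voter group $i$: - party $A$ benefits from attracting group $i$ if $x_i>\max\{\underline x(\mathbf x,\mathbf s),x_m\}$, and from alienating it if $x_i<\min\{\underline x(\mathbf x,\mathbf s),x_m\}$; - party $B$ benefits from attracting group $i$ if $x_i<\min\{\bar x(\mathbf x,\mathbf s),x_m\}$, and from alienating it if $x_i>\max\{\bar x(\mathbf x,\mathbf s),x_m\}$.
   Context: There are $N\ge2$ voter types with distinct bliss points $x_1<\cdots<x_N$ in $\mathbb R$ and shares $s_i>0$, $\sum_i s_i=1$; write $\mathbf x=(x_i)$, $\mathbf s=(s_i)$. Two parties $A,B$ simultaneously choose platforms in $[x_1,x_N]$. Let $\Delta_i(x_A,x_B)=(x_B-x_i)^2-(x_A-x_i)^2$. A common shock $\epsilon$ is uniform on $[-\phi,\phi]$ with $\phi>\max_{a,b\in[x_1,x_N],\,i}|\Delta_i(a,b)|$. Type $i$ supports $A$ iff $\Delta_i\ge\epsilon$, so with probability $\pi_i=\frac12+\frac{\Delta_i}{2\phi}$. Vote shares are $S_A(\epsilon)=\sum_i s_i\mathbf 1\{\Delta_i\ge\epsilon\}$, $S_B=1-S_A$. The power rule $\rho:[0,1]\to\mathbb R$ is strictly increasing (possibly discontinuous) with $\rho(s)+\rho(1-s)=\bar\rho$ for all $s$; $U:[\rho(0),\rho(1)]\to\mathbb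 R$ is continuous, strictly increasing, strictly concave; $\nu=U\circ\rho$ with $\nu(1)-\nu(0)=1$. Payoffs are $V_p=\mathbb E_\epsilon[\nu(S_p(\epsilon))]$. Equilibrium facts: put $\underline s_i=\sum_{j\le i}s_j$, $\bar s_i=\sum_{j\ge i}s_j$, $\underline s_0=\bar s_{N+1}=0$, $\underline x(\mathbf x,\mathbf s)=\sum_i[\nu(\underline s_i)-\nu(\underline s_{i-1})]x_i$ and $\bar x(\mathbf x,\mathbf s)=\sum_i[\nu(\bar s_i)-\nu(\bar s_{i+1})]x_i$. Then $\underline x<\bar x$ and the pure-strategy Nash equilibria are exactly $(x_A,x_B)=(\bar x,\underline x)$ and $(\underline x,\bar x)$. Let $\hat V_p(\mathbf x,\mathbf s)=V_p(\bar x,\underline x)$. The median $x_m$ is the midpoint of the set of points with at least half of the electorate weakly on either side. Attraction and alienation: let $\pi_i^A=\pi_i(\bar x(\mathbf x,\mathbf s),\underline x(\mathbf x,\mathbf s))$ be group $i$'s equilibrium probability of supporting $A$ and $\pi_i^B=1-\pi_i^A$, both viewed as functions of $x_i$ (with the equilibrium platforms responding to $x_i$ and all other primitives fixed). Party $p$ benefits from attracting group $i$ if a small movement of $x_i$ (in one of the two directions) that strictly raises $\hat V_p$ also strictly raises $\pi_i^p$, i.e. $\frac{d\hat V_p}{dx_i}\cdot\frac{d\pi_i^p}{dx_i}>0$; it benefits from alienating group $i$ if a small movement that strictly raises $\hat V_p$ strictly lowers $\pi_i^p$, i.e. $\frac{d\hat V_p}{dx_i}\cdot\frac{d\pi_i^p}{dx_i}<0$.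 *)

(* Defs.v *)
From HB Require Import structures.
From mathcomp Require Import all_boot all_order all_algebra.
From mathcomp Require Import all_classical all_reals all_analysis.

Set Implicit Arguments.
Unset Strict Implicit.
Unset Printing Implicit Defensive.

Import Order.TTheory GRing.Theory Num.Theory.
Import numFieldNormedType.Exports.

Local Open Scope classical_set_scope.
Local Open Scope ring_scope.

Inductive party := PartyA | PartyB.

Section Game.
Context {R : realType} {n : nat}.

(* There are n.+1 voter types, indexed from 0 by 'I_n.+1: x gives the bliss
   points, listed in increasing order, and s the shares. *)
Implicit Types (x s : 'I_n.+1 -> R) (phi : {posnum R}) (nu : R -> R).

Definition policy_space x : set R := `[x ord0, x ord_max].

Definition Delta x (i : 'I_n.+1) (xA xB : R) : R :=
  (xB - x i) ^+ 2 - (xA - x i) ^+ 2.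

Lemma shock_range phi : - phi%:num < phi%:num.
Proof. exact: gtrN. Qed.

Definition shock_law phi : probability (measurableTypeR R) R :=
  uniform_prob (shock_range phi).

Definition vote_share (p : party) x s (xA xB eps : R) : R :=
  let SA := \sum_(i | eps <= Delta x i xA xB) s i in
  if p is PartyA then SA else 1 - SA.

(* The expectation is that of a bounded step function, hence finite. *)
Definition payoff (p : party) x s phi nu (xA xB : R) : R :=
  fine 'E_(shock_law phi)[fun eps => nu (vote_share p x s xA xB eps)].

Definition support_prob (p : party) x phi (i : 'I_n.+1) (xA xB : R) : R :=
  let piA := fine (shock_law phi [set eps | eps <= Delta x i xA xB]) in
  if p is PartyA then piA else 1 - piA.

(* The sums over j < i and j > i are the cumulative shares of the types
   strictly to the left and to the right of type i (zero at the end types). *)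
Definition left_platform x s nu : R :=
  \sum_(i < n.+1) (nu (\sum_(j < n.+1 | (j <= i)%N) s j) -
                  nu (\sum_(j < n.+1 | (j < i)%N) s j)) * x i.

Definition right_platform x s nu : R :=
  \sum_(i < n.+1) (nu (\sum_(j < n.+1 | (i <= j)%N) s j) -
                  nu (\sum_(j < n.+1 | (i < j)%N) s j)) * x i.

(* Party A at the right platform and party B at the left one: this is, up to
   exchanging the parties, the only pure-strategy Nash equilibrium. *)
Definition eq_payoff (p : party) x s phi nu : R :=
  payoff p x s phi nu (right_platform x s nu) (left_platform x s nu).

Definition eq_support_prob (p : party) x s phi nu (i : 'I_n.+1) : R :=
  support_prob p x phi i (right_platform x s nu) (left_platform x s nu).

Definition median_set x s : set R :=
  [set m | 1 / 2 <= \sum_(i | x i <= m) s i /\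
           1 / 2 <= \sum_(i | m <= x i) s i].

(* median_set is a nonempty compact interval. *)
Definition median x s : R := (inf (median_set x s) + sup (median_set x s)) / 2.

(* Both quantities as functions of the bliss point t of type i, with the
   equilibrium platforms responding and everything else fixed. *)
Definition payoff_along (p : party) x s phi nu (i : 'I_n.+1) (t : R) : R :=
  eq_payoff p [eta x with i |-> t] s phi nu.

Definition support_along (p : party) x s phi nu (i : 'I_n.+1) (t : R) : R :=
  eq_support_prob p [eta x with i |-> t] s phi nu i.

Definition benefits_from_attracting (p : party) x s phi nu (i : 'I_n.+1) :=
  let V := payoff_along p x s phi nu i in
  let Pi := support_along p x s phi nu i in
  [/\ derivable V (x i) 1, derivable Pi (x i) 1 &
      0 < derive1 V (x i) * derive1 Pi (x i)].

Definition benefits_from_alienating (p : party) x s phi nu (i : 'I_n.+1) :=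
  let V := payoff_along p x s phi nu i in
  let Pi := support_along p x s phi nu i in
  [/\ derivable V (x i) 1, derivable Pi (x i) 1 &
      derive1 V (x i) * derive1 Pi (x i) < 0].

End Game.

Definition strictly_increasing_on {R : realType} (D : set R) (f : R -> R) :=
  forall u v, D u -> D v -> u < v -> f u < f v.

Definition strictly_concave_on {R : realType} (D : set R) (f : R -> R) :=
  forall u v t, D u -> D v -> u != v -> 0 < t < 1 ->
    t * f u + (1 - t) * f v < f (t * u + (1 - t) * v).

(* Main.v *)
(* A telescoping (layer-cake) sum writes nu of a vote share as an affine
   combination of the support indicators, whose coefficients are the weights
   l_i, r_i defining the platforms xl, xr. Since Delta_i is affine in x_i, this
   yields V_A = V_B = nu(0) + 1/2 + (xr - xl)^2 / (2 phi) at the equilibrium, so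
     dV/dx_i = (xr - xl) (r_i - l_i) / phi,
     phi dpi_i^A/dx_i = (r_i - l_i) (x_i - xl) + (xr - xl) (1 - r_i)
                      = (r_i - l_i) (x_i - xr) + (xr - xl) (1 - l_i).
   Strict concavity of U and symmetry of rho give r_i > l_i to the right of the
   median and r_i < l_i to its left. *)

Require Import Defs.
From mathcomp Require Import all_boot all_order all_algebra.
From mathcomp Require Import all_classical all_reals all_analysis.
From mathcomp Require Import ring lra.
Import Order.TTheory GRing.Theory Num.Theory.
Import numFieldNormedType.Exports.
Local Open Scope classical_set_scope.
Local Open Scope ring_scope.

Set Implicit Arguments.
Unset Strict Implicit.
Unset Printing Implicit Defensive.

(** * Expectations and tail probabilities under the uniform shock *)

Lemma expectation_step_fun d (T : measurableType d) (R : realType)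
    (P : probability T R) (I : finType) (A : I -> set T) (c : R) (a : I -> R) :
  (forall i, measurable (A i)) ->
  fine 'E_P[fun w => c + \sum_i a i * \1_(A i) w] =
  c + \sum_i a i * fine (P (A i)).
Proof.
move=> mA.
have intA i : P.-integrable [set: T] (fun w => (a i * \1_(A i) w)%:E).
  under eq_fun do rewrite EFinM.
  by apply: integrableZl => //; exact: integrable_indic.
rewrite unlock.
under eq_integral do rewrite EFinD -sumEFin.
rewrite integralD//=; last 2 first.
- exact: (finite_measure_integrable_cst P c measurableT).
- exact: integrable_sum.
rewrite integral_cst//= probability_setT mule1 integral_sum//.
rewrite (eq_bigr (fun i => (a i * fine (P (A i)))%:E)).
  by rewrite sumEFin.
move=> i _; under eq_integral do rewrite EFinM.
rewrite integralZl//; last exact: integrable_indic.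
rewrite integral_indic// setIT EFinM fineK//.
exact: fin_num_measure.
Qed.

(** The bound on [d] keeps the cutoff inside the support of the shock, where the distribution
    function is affine rather than constant at 0 or 1. *)
Lemma shock_law_ray (R : realType) (phi : {posnum R}) (d : R) :
  `|d| < phi%:num ->
  fine (shock_law phi [set e | e <= d]) = 1 / 2 + d / (2 * phi%:num).
Proof.
rewrite ltr_norml => /andP[d1 d2].
have -> : [set e : measurableTypeR R | e <= d] = `]-oo, d]%classic.
  by apply/seteqP; split=> e /=; rewrite in_itv.
rewrite /shock_law /uniform_prob/= /uniform_prob integral_uniform_pdf.
have -> : `]-oo, d]%classic `&` `[- phi%:num, phi%:num]%classic =
          `[- phi%:num, d]%classic :> set R.
  apply/seteqP; split=> e /=; rewrite !in_itv/=.
    by move=> [ed /andP[-> _]].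
  by move=> /andP[-> ed]; split=> //=; rewrite (le_trans ed)// ltW.
rewrite (eq_integral (fun=> (phi%:num - - phi%:num)^-1%:E)); last first.
  move=> e; rewrite inE/= in_itv/= => /andP[e1 e2].
  by rewrite /uniform_pdf e1 (le_trans e2)// ltW.
rewrite integral_cst//= lebesgue_measure_itv/= lte_fin d1 -EFinD -EFinM/=.
by field; rewrite gt_eqF//=; lra.
Qed.

(* Share of the first [k] types: the paper's lower cumulative share of type [i]
   is [cum_share s i.+1], its upper one is [1 - cum_share s i]. *)
Definition cum_share {R : realType} {n : nat} (s : 'I_n.+1 -> R) (k : nat) : R :=
  \sum_(j < n.+1 | (j < k)%N) s j.

(** * Cumulative shares and the location of the median *)

Section CumulativeShares.
Context {R : realType} {n : nat} (s : 'I_n.+1 -> R).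
Hypothesis s_positive : forall i, 0 < s i.
Hypothesis s_total : \sum_i s i = 1.

Lemma cum_share0 : cum_share s 0 = 0.
Proof. by rewrite /cum_share big_pred0. Qed.

Lemma cum_share_max : cum_share s n.+1 = 1.
Proof. by rewrite -s_total; apply: eq_bigl => j; rewrite ltn_ord. Qed.

Lemma cum_shareS (i : 'I_n.+1) : cum_share s i.+1 = cum_share s i + s i.
Proof.
rewrite /cum_share (bigD1 i)//= addrC; congr (_ + _); apply: eq_bigl => j.
by rewrite ltnS ltn_neqAle andbC.
Qed.

Lemma cum_share_compl (k : nat) :
  \sum_(j < n.+1 | (k <= j)%N) s j = 1 - cum_share s k.
Proof.
rewrite -s_total [X in X - _](bigID (fun j : 'I_n.+1 => (j < k)%N))/=.
rewrite addrAC subrr add0r.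
by apply: eq_bigl => j; rewrite leqNgt.
Qed.

Lemma cum_share_le (k l : nat) : (k <= l)%N -> cum_share s k <= cum_share s l.
Proof.
move=> kl; rewrite /cum_share.
rewrite [leRHS](bigID (fun j : 'I_n.+1 => (j < k)%N))/=.
rewrite (eq_bigl (fun j : 'I_n.+1 => (j < l)%N && (j < k)%N)); last first.
  by move=> j; case: ltnP => jk; rewrite ?andbF// (leq_trans jk kl).
by rewrite lerDl sumr_ge0// => j _; rewrite ltW.
Qed.

Lemma cum_share_lt (i : 'I_n.+1) : cum_share s i < cum_share s i.+1.
Proof. by rewrite cum_shareS ltrDl. Qed.

Lemma cum_share_ge0 k : 0 <= cum_share s k.
Proof. by rewrite -cum_share0 cum_share_le. Qed.

Lemma cum_share_le1 k : (k <= n.+1)%N -> cum_share s k <= 1.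
Proof. by move=> kn; rewrite -cum_share_max cum_share_le. Qed.

Section Median.
Context (x : 'I_n.+1 -> R).
Hypothesis x_increasing : forall i j : 'I_n.+1, (i < j)%N -> x i < x j.

Lemma bliss_le i j : (x i <= x j) = (i <= j)%N.
Proof.
case: ltngtP => [/x_increasing/ltW//|/x_increasing|/val_inj->]; last exact: lexx.
by rewrite leNgt => ->.
Qed.

(** If [m] lay to the left of [x i], every type at or below [m] would precede [i], and those types
    hold less than half of the electorate. *)
Lemma median_set_ge (i : 'I_n.+1) m :
  cum_share s i < 1 / 2 -> median_set x s m -> x i <= m.
Proof.
move=> si [+ _]; rewrite [x i <= m]leNgt; apply: contraTN => mxi.
rewrite -ltNge; apply: le_lt_trans si.
rewrite /cum_share [leRHS](bigID (fun j => x j <= m))/=.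
rewrite (eq_bigl (fun j : 'I_n.+1 => (j < i)%N && (x j <= m))).
  by rewrite lerDl sumr_ge0// => j _; rewrite ltW.
move=> j; case: leP => xjm; rewrite ?andbF// andbT.
by rewrite ltnNge -bliss_le -ltNge (le_lt_trans xjm).
Qed.

Lemma median_set_le (i : 'I_n.+1) m :
  1 / 2 < cum_share s i.+1 -> median_set x s m -> m <= x i.
Proof.
move=> si [_]; rewrite [m <= x i]leNgt; apply: contraTN => mxi.
rewrite -ltNge; apply: (@le_lt_trans _ _ (1 - cum_share s i.+1)); last lra.
rewrite -cum_share_compl [leRHS](bigID (fun j => m <= x j))/=.
rewrite (eq_bigl (fun j : 'I_n.+1 => (i < j)%N && (m <= x j))).
  by rewrite lerDl sumr_ge0// => j _; rewrite ltW.
move=> j; case: leP => xjm; rewrite ?andbF// andbT.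
by rewrite ltnNge -bliss_le -ltNge (lt_le_trans mxi).
Qed.

(** The witness is the bliss point of the first type at which the cumulative share reaches one half;
    minimality leaves at most half before it. Together with the two bounds below, this makes [inf]
    and [sup] in [median] genuine rather than default values. *)
Lemma median_set_nonempty : median_set x s !=set0.
Proof.
have ex : exists k, (k < n.+1)%N && (1 / 2 <= cum_share s k.+1).
  by exists n; rewrite ltnSn cum_share_max; lra.
case: (ex_minnP ex) => k /andP[kn sk] kmin.
pose i := Ordinal kn; exists (x i); split.
  by rewrite (eq_bigl (fun j : 'I_n.+1 => (j < k.+1)%N))// => j; rewrite bliss_le.
rewrite (eq_bigl (fun j : 'I_n.+1 => (k <= j)%N)); last first.
  by move=> j; rewrite bliss_le.
rewrite cum_share_compl; suff : cum_share s k <= 1 / 2 by lra.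
case: k kn sk kmin {i} => [|k] kn sk kmin; first by rewrite cum_share0; lra.
rewrite leNgt; apply/negP => /ltW sk'.
have /kmin : (k < n.+1)%N && (1 / 2 <= cum_share s k.+1) by rewrite ltnW.
by rewrite ltnn.
Qed.

Lemma median_set_lbound : has_lbound (median_set x s).
Proof.
exists (x ord0) => m; apply: median_set_ge.
by rewrite cum_share0; lra.
Qed.

Lemma median_set_ubound : has_ubound (median_set x s).
Proof.
exists (x ord_max) => m; apply: median_set_le.
by rewrite cum_share_max; lra.
Qed.

(** Used in contrapositive form: a type strictly to the right of the median has at least half of the
    electorate before it. *)
Lemma median_ge (i : 'I_n.+1) : cum_share s i < 1 / 2 -> x i <= median x s.
Proof.
move=> si; have [m Mm] := median_set_nonempty.
have : x i <= inf (median_set x s).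
  by apply: lb_le_inf; [exists m|move=> z; exact: median_set_ge].
have := median_set_ge si Mm.
have := ub_le_sup median_set_ubound Mm.
by rewrite /median; lra.
Qed.

Lemma median_le (i : 'I_n.+1) : 1 / 2 < cum_share s i.+1 -> median x s <= x i.
Proof.
move=> si; have [m Mm] := median_set_nonempty.
have : sup (median_set x s) <= x i.
  by apply: ge_sup; [exists m|move=> z; exact: median_set_le].
have := median_set_le si Mm.
have := ge_inf median_set_lbound Mm.
by rewrite /median; lra.
Qed.

End Median.
End CumulativeShares.

(** * Platform weights, telescoping and concavity *)

Definition left_weight {R : realType} {n : nat} (s : 'I_n.+1 -> R) (nu : R -> R)
    (i : 'I_n.+1) : R :=
  nu (cum_share s i.+1) - nu (cum_share s i).

(** Upper cumulative shares are written as complements, so that both weights are increments along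
    the one sequence [cum_share s]. *)
Definition right_weight {R : realType} {n : nat} (s : 'I_n.+1 -> R) (nu : R -> R)
    (i : 'I_n.+1) : R :=
  nu (1 - cum_share s i) - nu (1 - cum_share s i.+1).

(** The layer-cake identity for an electorate whose supporters are the types from [k] on. *)
Lemma sum_telescope_ge (R : realType) (N : nat) (g : nat -> R) (k : nat) :
  (k <= N)%N ->
  \sum_(i < N) (g i.+1 - g i) * (k <= i)%:R = g N - g k.
Proof.
move=> kN; rewrite -telescope_sumr// big_geq_mkord [RHS]big_mkcond/=.
by apply: eq_bigr => i _; case: leqP; rewrite ?mulr1 ?mulr0.
Qed.

Lemma sum_telescope (R : realType) (N : nat) (g : nat -> R) :
  \sum_(i < N) (g i.+1 - g i) = g N - g 0%N.
Proof.
by rewrite -(sum_telescope_ge g (leq0n N)); apply: eq_bigr => i _; rewrite mulr1.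
Qed.

Lemma monotone_predicate_threshold (n : nat) (c : pred 'I_n.+1) :
  (forall i j : 'I_n.+1, (i <= j)%N -> c i -> c j) ->
  exists2 k, (k <= n.+1)%N & forall i, c i = (k <= i)%N.
Proof.
move=> cmono; have [[i ci]|none] := pselect (exists i, c i); last first.
  (* A threshold past the last index encodes a predicate that no type satisfies. *)
  exists n.+1 => // i; rewrite leqNgt ltn_ord/=.
  by apply/negP => ci; apply: none; exists i.
case: (arg_minnP (fun i : 'I_n.+1 => nat_of_ord i) ci) => k ck kmin.
exists k => [|j]; first exact: ltnW.
by apply/idP/idP => [/kmin//|kj]; apply: cmono ck.
Qed.

(** Abel summation, with [h] shifted by its initial value so that the boundary term vanishes once
    [h] agrees at both ends. *)
Lemma summation_by_parts (R : realType) (n : nat) (h x : nat -> R) :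
  \sum_(i < n.+1) (h i - h i.+1) * x i =
  \sum_(i < n) (h i.+1 - h 0%N) * (x i.+1 - x i) - (h n.+1 - h 0%N) * x n.
Proof.
elim: n => [|n IH]; first by rewrite big_ord_recr !big_ord0/=; ring.
by rewrite big_ord_recr/= IH [in RHS]big_ord_recr/=; ring.
Qed.

Lemma convex_combination_between (R : realType) (n : nat) (w x : 'I_n.+1 -> R)
    (a b : R) :
  (forall i, 0 <= w i) -> \sum_i w i = 1 -> (forall i, a <= x i <= b) ->
  a <= \sum_i w i * x i <= b.
Proof.
move=> w0 w1 xab; rewrite -[a]mul1r -[b]mul1r -w1 !mulr_suml.
by apply/andP; split; apply: ler_sum => i _; rewrite ler_wpM2l//;
  have /andP[] := xab i.
Qed.

(** The inner points are convex combinations of [a] and [b] with the weights [t] and [1 - t]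
    exchanged; adding the two concavity inequalities eliminates [t]. *)
Lemma strictly_concave_spread (R : realType) (D : set R) (U : R -> R) (a b u v : R) :
  strictly_concave_on D U -> D a -> D b -> a < u < b -> v = a + b - u ->
  U a + U b < U u + U v.
Proof.
move=> Uc Da Db /andP[au ub] ->; pose t := (b - u) / (b - a).
have ba : 0 < b - a by lra.
have t01 : 0 < t < 1.
  by rewrite /t divr_gt0 ?ltr_pdivrMr ?mul1r/=; lra.
have t01' : 0 < 1 - t < 1 by lra.
have ab : a != b by rewrite lt_eqF//; lra.
have := Uc _ _ _ Da Db ab t01; have := Uc _ _ _ Da Db ab t01'.
have -> : t * a + (1 - t) * b = u by rewrite /t; field; rewrite gt_eqF.
have -> : (1 - t) * a + (1 - (1 - t)) * b = a + b - u.
  by rewrite /t; field; rewrite gt_eqF.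
by lra.
Qed.

Section WeightSums.
Context {R : realType} {n : nat} (x s : 'I_n.+1 -> R) (nu : R -> R).
Hypothesis s_total : \sum_i s i = 1.

Lemma left_platformE : left_platform x s nu = \sum_i left_weight s nu i * x i.
Proof. by []. Qed.

Lemma right_platformE : right_platform x s nu = \sum_i right_weight s nu i * x i.
Proof.
by apply: eq_bigr => i _; rewrite /right_weight -!cum_share_compl.
Qed.

Hypothesis nu_normalized : nu 1 - nu 0 = 1.

Lemma sum_left_weight : \sum_i left_weight s nu i = 1.
Proof.
by rewrite (sum_telescope _ (fun k => nu (cum_share s k))) cum_share0
  cum_share_max.
Qed.

Lemma sum_right_weight : \sum_i right_weight s nu i = 1.
Proof.
rewrite -[RHS]nu_normalized -[RHS]opprB.
have := sum_telescope n.+1 (fun k => nu (1 - cum_share s k)).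
rewrite cum_share_max// cum_share0 subrr subr0 => <-.
by rewrite -sumrN; apply: eq_bigr => i _; rewrite opprB.
Qed.

End WeightSums.

(** * How concavity and symmetry order the weights and the platforms *)

Section PowerRule.
Context {R : realType} (rho U : R -> R) (rhobar : R).
Hypothesis rho_increasing : strictly_increasing_on `[0, 1] rho.
Hypothesis rho_symmetric : forall u : R, 0 <= u <= 1 -> rho u + rho (1 - u) = rhobar.
Hypothesis U_increasing : strictly_increasing_on `[rho 0, rho 1] U.
Hypothesis U_concave : strictly_concave_on `[rho 0, rho 1] U.
Let nu := U \o rho.

Lemma rho_lt u v : 0 <= u -> u < v -> v <= 1 -> rho u < rho v.
Proof. by move=> u0 uv v1; apply: rho_increasing => //=; rewrite in_itv/=; lra. Qed.

Lemma rho_itv u : 0 <= u <= 1 -> `[rho 0, rho 1]%classic (rho u).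
Proof.
move=> /andP[u0 u1]; rewrite /= in_itv/=; apply/andP; split.
  by move: u0; rewrite [0 <= u]le_eqVlt => /predU1P[<-|u0]; [exact: lexx|rewrite ltW// rho_lt].
by move: u1; rewrite [u <= 1]le_eqVlt => /predU1P[->|u1]; [exact: lexx|rewrite ltW// rho_lt].
Qed.

Lemma nu_lt u v : 0 <= u -> u < v -> v <= 1 -> nu u < nu v.
Proof.
move=> u0 uv v1; apply: U_increasing; last exact: rho_lt.
- by apply: rho_itv; lra.
- by apply: rho_itv; lra.
Qed.

(* By symmetry of [rho], the pairs [rho u, rho (1 - u)] and [rho v, rho (1 - v)]
   have the same sum, and the second pair is more spread out. *)
Lemma nu_spread u v : 0 <= u -> u < v -> v <= 1 -> 1 < u + v ->
  nu (1 - v) + nu v < nu (1 - u) + nu u.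
Proof.
move=> u0 uv v1 uv1; rewrite [ltRHS]addrC.
apply: (strictly_concave_spread U_concave).
- by apply: rho_itv; lra.
- by apply: rho_itv; lra.
- by apply/andP; split; apply: rho_lt; lra.
- have Hu : 0 <= u <= 1 by lra.
  have Hv : 0 <= v <= 1 by lra.
  by have := rho_symmetric Hu; have := rho_symmetric Hv; lra.
Qed.

(** Both sides are invariant under reflection about one half, which turns [u + v < 1] into the case
    of [nu_spread]. *)
Lemma nu_spread_low u v : 0 <= u -> u < v -> v <= 1 -> u + v < 1 ->
  nu (1 - u) + nu u < nu (1 - v) + nu v.
Proof.
move=> u0 uv v1 uv1.
have := @nu_spread (1 - v) (1 - u); rewrite !subKr [nu u + _]addrC [nu v + _]addrC.
by apply; lra.
Qed.

Section Weights.
Context {n : nat} (x s : 'I_n.+2 -> R).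
Hypothesis x_increasing : forall i j : 'I_n.+2, (i < j)%N -> x i < x j.
Hypothesis s_positive : forall i, 0 < s i.
Hypothesis s_total : \sum_i s i = 1.
Hypothesis nu_normalized : nu 1 - nu 0 = 1.

Lemma left_weight_gt0 i : 0 < left_weight s nu i.
Proof.
rewrite subr_gt0; apply: nu_lt; first exact: cum_share_ge0.
- exact: cum_share_lt.
- exact: cum_share_le1.
Qed.

Lemma right_weight_gt0 i : 0 < right_weight s nu i.
Proof.
rewrite subr_gt0; have := cum_share_le1 s_positive s_total (ltn_ord i).
have := cum_share_ge0 s_positive i; have := cum_share_lt s_positive i => ? ? ?.
by apply: nu_lt; lra.
Qed.

Lemma left_weight_le1 i : left_weight s nu i <= 1.
Proof.
rewrite -(sum_left_weight s_total nu_normalized) (bigD1 i)//= lerDl sumr_ge0// => j _.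
by rewrite ltW// left_weight_gt0.
Qed.

Lemma right_weight_le1 i : right_weight s nu i <= 1.
Proof.
rewrite -(sum_right_weight s_total nu_normalized) (bigD1 i)//= lerDl sumr_ge0// => j _.
by rewrite ltW// right_weight_gt0.
Qed.

(** The weight difference is the drop of [nu (1 - u) + nu u] between the consecutive cumulative
    shares [u < v] around the type. To the right of the median [u] is at least one half, so
    [u + v > 1]. *)
Lemma left_lt_right_weight (i : 'I_n.+2) :
  median x s < x i -> left_weight s nu i < right_weight s nu i.
Proof.
move=> mi; have si : 1 / 2 <= cum_share s i.
  rewrite leNgt; apply/negP => /(median_ge s_positive s_total x_increasing).
  by rewrite leNgt mi.
have lti := cum_share_lt s_positive i.
have := nu_spread (cum_share_ge0 s_positive i) lti
  (cum_share_le1 s_positive s_total (ltn_ord i)).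
by rewrite /left_weight /right_weight; lra.
Qed.

Lemma right_lt_left_weight (i : 'I_n.+2) :
  x i < median x s -> right_weight s nu i < left_weight s nu i.
Proof.
move=> mi; have si : cum_share s i.+1 <= 1 / 2.
  rewrite leNgt; apply/negP => /(median_le s_positive s_total x_increasing).
  by rewrite leNgt mi.
have lti := cum_share_lt s_positive i.
have := nu_spread_low (cum_share_ge0 s_positive i) lti
  (cum_share_le1 s_positive s_total (ltn_ord i)).
by rewrite /left_weight /right_weight; lra.
Qed.

(** The gap between the platforms is the sum of [(h i - h i.+1) * x i], and [h] agrees at shares 0
    and 1. Abel summation turns it into gaps of bliss points with coefficients [h i.+1 - h 0],
    positive because an interior pair of shares is less spread out than the pair 0, 1. *)
Lemma left_lt_right_platform : left_platform x s nu < right_platform x s nu.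
Proof.
pose h k := nu (1 - cum_share s k) + nu (cum_share s k).
rewrite -subr_gt0 right_platformE// left_platformE -sumrB.
have hn : h n.+2 - h 0%N = 0.
  by rewrite /h cum_share_max// cum_share0 subrr subr0; ring.
rewrite (eq_bigr (fun i : 'I_n.+2 => (h i - h i.+1) * x (inord i))); last first.
  by move=> i _; rewrite inord_val /h /left_weight /right_weight; ring.
rewrite (summation_by_parts n.+1 h (fun k => x (inord k))) hn mul0r subr0.
have pos (i : 'I_n.+1) :
    0 < (h i.+1 - h 0%N) * (x (inord i.+1) - x (inord i)).
  have iS : (i.+1 < n.+2)%N by rewrite ltnS.
  have i0 : (i < n.+2)%N := ltnW iS.
  rewrite mulr_gt0// subr_gt0; last first.
    by apply: x_increasing; rewrite !inordK.
  (* One strict increment on each side keeps [cum_share s i.+1] away from both 0 and 1. *)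
  have lt0 := cum_share_lt s_positive (Ordinal i0).
  have lt1 := cum_share_lt s_positive (Ordinal iS).
  have := cum_share_ge0 s_positive i.
  have := cum_share_le1 s_positive s_total iS.
  move: lt0 lt1 => /= ? ? ? ?.
  by rewrite /h cum_share0; apply: nu_spread_low; lra.
(* With at least two types there is a first gap, which makes the inequality strict. *)
rewrite big_ord_recl ltr_pwDl ?pos// sumr_ge0// => i _.
exact: ltW (pos (lift ord0 i)).
Qed.

End Weights.
End PowerRule.

Lemma indic_ray (R : realType) (d e : R) :
  \1_[set t | t <= d] e = (e <= d)%R%:R :> R.
Proof. by rewrite indicE; congr (nat_of_bool _)%:R; apply/idP/idP; rewrite inE. Qed.

(** * Closed forms of payoffs and support probabilities *)

Section EquilibriumPayoffs.
Context {R : realType} {n : nat} (y s : 'I_n.+1 -> R) (phi : {posnum R}).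
Context (nu : R -> R).
Hypothesis y_nondecreasing : forall i j : 'I_n.+1, (i <= j)%N -> y i <= y j.
Hypothesis s_total : \sum_i s i = 1.
Hypothesis nu_normalized : nu 1 - nu 0 = 1.
Let xl := left_platform y s nu.
Let xr := right_platform y s nu.
Hypothesis xl_lt_xr : xl < xr.
Hypothesis Delta_small : forall i, `|Delta y i xr xl| < phi%:num.

(** [Delta] is affine in the bliss point with slope [2 * (xr - xl)], so at every shock the
    supporters of [PartyA] form an upper set of types. *)
Lemma supporters_threshold e : exists2 k, (k <= n.+1)%N &
  forall i, (e <= Delta y i xr xl) = (k <= i)%N.
Proof.
apply: (@monotone_predicate_threshold n (fun i => e <= Delta y i xr xl)).
move=> i j /y_nondecreasing ij /le_trans; apply.
have -> : Delta y j xr xl = Delta y i xr xl + 2 * ((xr - xl) * (y j - y i)).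
  by rewrite /Delta; ring.
by rewrite lerDl !mulr_ge0// subr_ge0// ltW.
Qed.

Lemma nu_vote_shareA e :
  nu (vote_share PartyA y s xr xl e) =
  nu 0 + \sum_i right_weight s nu i * \1_[set t | t <= Delta y i xr xl] e.
Proof.
have [k kn ek] := supporters_threshold e.
rewrite /vote_share (eq_bigl _ _ ek) cum_share_compl//.
have := sum_telescope_ge (fun j => - nu (1 - cum_share s j)) kn.
rewrite cum_share_max// subrr => /eqP; rewrite opprK addrC -subr_eq opprK => /eqP.
rewrite addrC => <-; congr (_ + _); apply: eq_bigr => i _.
by rewrite indic_ray ek /right_weight addrC opprK.
Qed.

(** [PartyB] holds [cum_share s k]; the left weights of the types lost to [PartyA] telescope to the
    shortfall from [nu 1]. *)
Lemma nu_vote_shareB e :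
  nu (vote_share PartyB y s xr xl e) =
  nu 1 + \sum_i - left_weight s nu i * \1_[set t | t <= Delta y i xr xl] e.
Proof.
have [k kn ek] := supporters_threshold e.
rewrite /vote_share (eq_bigl _ _ ek) cum_share_compl// subKr.
have := sum_telescope_ge (fun j => nu (cum_share s j)) kn.
rewrite cum_share_max// => sumE.
rewrite (eq_bigr (fun i : 'I_n.+1 =>
  - ((nu (cum_share s i.+1) - nu (cum_share s i)) * (k <= i)%:R))).
  by rewrite sumrN sumE; ring.
by move=> i _; rewrite indic_ray ek mulNr.
Qed.

Lemma measurable_ray (d : R) :
  measurable ([set t | t <= d] : set (measurableTypeR R)).
Proof.
have -> : [set t : measurableTypeR R | t <= d] = `]-oo, d]%classic.
  by apply/seteqP; split=> e /=; rewrite in_itv.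
exact: measurable_itv.
Qed.

(** Since [Delta] is affine in [y i], only the weighted mean matters. That mean is [xr] for the
    right weights and [xl] for the left ones, which produces the square of [xr - xl] up to sign. *)
Lemma Delta_expected (w : 'I_n.+1 -> R) : \sum_i w i = 1 ->
  \sum_i w i * (1 / 2 + Delta y i xr xl / (2 * phi%:num)) =
  1 / 2 + (xr - xl) * (2 * (\sum_i w i * y i) - xl - xr) / (2 * phi%:num).
Proof.
move=> w1; pose c := (xr - xl) / (2 * phi%:num).
rewrite (eq_bigr (fun i =>
    w i * (1 / 2 - c * (xl + xr)) + (w i * y i) * (2 * c))); last first.
  by move=> i _; rewrite /Delta /c; ring.
by rewrite big_split/= -!mulr_suml w1 /c; ring.
Qed.

Lemma eq_payoffE p :
  eq_payoff p y s phi nu = nu 0 + 1 / 2 + (xr - xl) ^+ 2 / (2 * phi%:num).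
Proof.
case: p; rewrite /eq_payoff /payoff -/xl -/xr.
- under [X in expectation _ X]eq_fun do rewrite nu_vote_shareA.
  rewrite expectation_step_fun; last by move=> i; exact: measurable_ray.
  under eq_bigr do rewrite shock_law_ray//.
  rewrite Delta_expected ?sum_right_weight// -right_platformE// -/xr.
  by rewrite /shock_law; ring.
- under [X in expectation _ X]eq_fun do rewrite nu_vote_shareB.
  rewrite expectation_step_fun; last by move=> i; exact: measurable_ray.
  under eq_bigr do rewrite mulNr shock_law_ray//.
  rewrite sumrN Delta_expected ?sum_left_weight// -left_platformE -/xl.
  (* The normalization turns [nu 1 - 1 / 2] into [nu 0 + 1 / 2], so both parties get the same
     value. *)
  by rewrite -(subrK (nu 0) (nu 1)) nu_normalized; field.
Qed.

Lemma eq_support_probE p i :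
  eq_support_prob p y s phi nu i =
  1 / 2 + (if p is PartyA then 1 else - 1) * Delta y i xr xl / (2 * phi%:num).
Proof.
rewrite /eq_support_prob /support_prob (shock_law_ray (Delta_small i)).
by case: p; rewrite -/xl -/xr; field.
Qed.

End EquilibriumPayoffs.

(** * Derivatives with respect to one bliss point *)

Section MovingBlissPoint.
Context {R : realType} {n : nat} (x s : 'I_n.+1 -> R) (nu : R -> R).
Hypothesis s_total : \sum_i s i = 1.

Lemma moved_bliss i t j :
  [eta x with i |-> t] j = x j + (j == i)%:R * (t - x i).
Proof. by rewrite /=; case: eqVneq => [->|_]; rewrite ?mul1r ?mul0r; ring. Qed.

Lemma sum_moved_bliss (w : 'I_n.+1 -> R) i t :
  \sum_j w j * [eta x with i |-> t] j = \sum_j w j * x j + w i * (t - x i).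
Proof.
under eq_bigr do rewrite moved_bliss mulrDr.
rewrite big_split/=; congr (_ + _); rewrite (bigD1 i)//= eqxx mul1r big1 ?addr0//.
by move=> j /negbTE ->; rewrite mul0r mulr0.
Qed.

(** The weights depend on shares only, so the platform is affine in [t]. *)
Lemma left_platform_moved i t :
  left_platform [eta x with i |-> t] s nu =
  left_platform x s nu + left_weight s nu i * (t - x i).
Proof. by rewrite !left_platformE sum_moved_bliss. Qed.

Lemma right_platform_moved i t :
  right_platform [eta x with i |-> t] s nu =
  right_platform x s nu + right_weight s nu i * (t - x i).
Proof. by rewrite !right_platformE// sum_moved_bliss. Qed.

Section Derivatives.
Hypothesis x_increasing : forall i j : 'I_n.+1, (i < j)%N -> x i < x j.
Hypothesis nu_normalized : nu 1 - nu 0 = 1.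
Context (phi : {posnum R}) (i : 'I_n.+1).
Let xl := left_platform x s nu.
Let xr := right_platform x s nu.
Let l := left_weight s nu i.
Let r := right_weight s nu i.
Hypothesis xl_lt_xr : xl < xr.
Hypothesis Delta_small : forall j, `|Delta x j xr xl| < phi%:num.

Let cvg_affine (a b : R) : a + b * (t - x i) @[t --> x i] --> a.
Proof.
rewrite -[X in _ --> X]addr0 -[X in a + X](mulr0 b) -(subrr (x i)).
apply: cvgD; first exact: cvg_cst.
by apply: cvgMr; apply: cvgB; [exact: cvg_id|exact: cvg_cst].
Qed.

Let near_affine_gt0 (a b : R) : 0 < a -> \forall t \near x i, 0 < a + b * (t - x i).
Proof. by move: (@cvg_affine a b) => /cvgr_gt; apply. Qed.

(** This and the next two facts extend the hypotheses of the closed forms to all [t] near [x i]: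
    they follow from finitely many strict inequalities between functions continuous in [t]. *)
Let order_near : \forall t \near x i, forall j k : 'I_n.+1, (j <= k)%N ->
  [eta x with i |-> t] j <= [eta x with i |-> t] k.
Proof.
apply: (filter_forall (nbhs_filter (x i))) => j; apply: (filter_forall (nbhs_filter (x i))) => k.
case: (ltngtP j k) => [jk|jk|/val_inj ->]; last 2 first.
- by apply: nearW => t.
- by apply: nearW => t _; exact: lexx.
have : \forall t \near x i,
    0 < (x k - x j) + ((k == i)%:R - (j == i)%:R) * (t - x i).
  by apply: near_affine_gt0; rewrite subr_gt0 x_increasing.
by move=> H; apply: filterS H => t; rewrite !moved_bliss => ? _; lra.
Qed.

Let platforms_near : \forall t \near x i,
  left_platform [eta x with i |-> t] s nu < right_platform [eta x with i |-> t] s nu.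
Proof.
have : \forall t \near x i, 0 < (xr - xl) + (r - l) * (t - x i).
  by apply: near_affine_gt0; rewrite subr_gt0.
by move=> H; apply: filterS H => t; rewrite left_platform_moved right_platform_moved
  -/xl -/xr -/l -/r; lra.
Qed.

Let Delta_near : \forall t \near x i, forall j,
  `|Delta [eta x with i |-> t] j (right_platform [eta x with i |-> t] s nu)
      (left_platform [eta x with i |-> t] s nu)| < phi%:num.
Proof.
(* The indicator [e] accounts for the moving type, whose distance to a platform changes through its
   own bliss point as well. *)
apply: (filter_forall (nbhs_filter (x i))) => j; pose e : R := (j == i)%:R.
have : (((xl - x j) + (l - e) * (t - x i)) ^+ 2 -
        ((xr - x j) + (r - e) * (t - x i)) ^+ 2) @[t --> x i] --> Delta x j xr xl.
  by apply: cvgB; apply: cvgM; exact: cvg_affine.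
move=> /cvgr_norm_lt /(_ _ (Delta_small j)) H; apply: filterS H => t.
rewrite /Delta moved_bliss left_platform_moved right_platform_moved.
rewrite -/xl -/xr -/l -/r -/e; congr (`| _ ^+ 2 - _ ^+ 2 | < _); ring.
Qed.

(** The closed form holds only near [x i], which suffices for a derivative there; in it the platform
    gap has slope [r - l]. *)
Lemma is_derive_payoff_along p :
  is_derive (x i) 1 (payoff_along p x s phi nu i) ((xr - xl) * (r - l) / phi%:num).
Proof.
apply: (@near_eq_is_derive _ _ _ (fun t : R => nu 0 + 1 / 2 +
    ((xr - xl) + (r - l) * (t - x i)) ^+ 2 / (2 * phi%:num))).
  near=> t; rewrite /payoff_along eq_payoffE//; last 3 first.
  - by near: t; exact: order_near.
  - by near: t; exact: platforms_near.
  - by near: t; exact: Delta_near.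
  rewrite left_platform_moved right_platform_moved -/xl -/xr -/l -/r.
  by congr (_ + _ ^+ 2 / _); ring.
apply: is_derive_eq; rewrite /GRing.scale/=.
by field.
Unshelve. all: by end_near. Qed.

(** The formula is kept symmetric in the two platforms, so that it can later be regrouped around
    either one. *)
Lemma is_derive_support_along p :
  is_derive (x i) 1 (support_along p x s phi nu i)
    ((if p is PartyA then 1 else - 1) *
     ((r - l) * (2 * x i - xl - xr) + (xr - xl) * (2 - l - r)) / (2 * phi%:num)).
Proof.
apply: (@near_eq_is_derive _ _ _ (fun t : R => 1 / 2 +
    (if p is PartyA then 1 else - 1) *
    (((xl - x i) + (l - 1) * (t - x i)) ^+ 2 -
     ((xr - x i) + (r - 1) * (t - x i)) ^+ 2) / (2 * phi%:num))).
  near=> t; rewrite /support_along eq_support_probE//; last 1 first.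
  - by near: t; exact: Delta_near.
  rewrite /Delta left_platform_moved right_platform_moved -/xl -/xr -/l -/r /= eqxx.
  by congr (_ + _ * (_ ^+ 2 - _ ^+ 2) / _); ring.
apply: is_derive_eq; rewrite /GRing.scale/=.
by field.
Unshelve. all: by end_near. Qed.

End Derivatives.
End MovingBlissPoint.

(** * Signs of the derivatives *)

(** This makes the lower bound on [phi], assumed for platforms in the policy space, available at the
    equilibrium. *)
Lemma platform_in_policy_space (R : realType) (n : nat) (x s : 'I_n.+1 -> R)
    (w : 'I_n.+1 -> R) :
  (forall i j : 'I_n.+1, (i < j)%N -> x i < x j) ->
  (forall i, 0 < w i) -> \sum_i w i = 1 -> policy_space x (\sum_i w i * x i).
Proof.
move=> x_increasing w0 w1; rewrite /policy_space/= in_itv/=.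
apply: convex_combination_between => // i; first exact: ltW.
by rewrite !bliss_le//= -ltnS ltn_ord.
Qed.

Theorem proposition4 (R : realType) (n : nat) (x s : 'I_n.+2 -> R)
    (phi : {posnum R}) (rho U : R -> R) (rhobar : R)
    (x_increasing : forall i j : 'I_n.+2, (i < j)%N -> x i < x j)
    (s_positive : forall i, 0 < s i)
    (s_total : \sum_i s i = 1)
    (phi_large : forall (i : 'I_n.+2) (a b : R),
       policy_space x a -> policy_space x b -> `|Delta x i a b| < phi%:num)
    (rho_increasing : strictly_increasing_on `[0, 1] rho)
    (rho_symmetric : forall u : R, 0 <= u <= 1 -> rho u + rho (1 - u) = rhobar)
    (U_continuous : {within `[rho 0, rho 1], continuous U})
    (U_increasing : strictly_increasing_on `[rho 0, rho 1] U)
    (U_concave : strictly_concave_on `[rho 0, rho 1] U)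
    (nu_normalized : (U \o rho) 1 - (U \o rho) 0 = 1)
    (i : 'I_n.+2) :
  let nu := U \o rho in
  let xl := left_platform x s nu in
  let xr := right_platform x s nu in
  let xm := median x s in
  ((x i > Num.max xl xm -> benefits_from_attracting PartyA x s phi nu i) /\
   (x i < Num.min xl xm -> benefits_from_alienating PartyA x s phi nu i)) /\
  ((x i < Num.min xr xm -> benefits_from_attracting PartyB x s phi nu i) /\
   (x i > Num.max xr xm -> benefits_from_alienating PartyB x s phi nu i)).
Proof.
move=> nu xl xr xm.
have weight_gt0 j : 0 < left_weight s nu j /\ 0 < right_weight s nu j.
  by split; [exact: left_weight_gt0|exact: right_weight_gt0].
have xl_lt_xr : xl < xr.
  exact: (left_lt_right_platform rho_increasing rho_symmetric U_concave).
have small j : `|Delta x j xr xl| < phi%:num.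
  apply: phi_large; last first.
    apply: platform_in_policy_space => // [k|]; first by have [] := weight_gt0 k.
    exact: sum_left_weight.
  rewrite /xr right_platformE//.
  apply: platform_in_policy_space => // [k|]; first by have [] := weight_gt0 k.
  exact: sum_right_weight.
pose l := left_weight s nu i; pose r := right_weight s nu i.
have l1 : l <= 1 by exact: left_weight_le1.
have r1 : r <= 1 by exact: right_weight_le1.
have l_lt_r : xm < x i -> l < r.
  exact: (left_lt_right_weight rho_increasing rho_symmetric U_concave).
have r_lt_l : x i < xm -> r < l.
  exact: (right_lt_left_weight rho_increasing rho_symmetric U_concave).
(* Up to positive factors, [r - l] is the derivative of the payoff and [e p * E] that of the support
   probability. *)
pose e p : R := if p is PartyA then 1 else - 1.
pose E := (r - l) * (2 * x i - xl - xr) + (xr - xl) * (2 - l - r).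
have derivs p : let V := payoff_along p x s phi nu i in
    let Pi := support_along p x s phi nu i in
    [/\ derivable V (x i) 1, derivable Pi (x i) 1 &
        exists2 c : R, 0 < c &
          derive1 V (x i) * derive1 Pi (x i) = c * (e p * ((r - l) * E))].
  have dV := is_derive_payoff_along s_total x_increasing nu_normalized
    i xl_lt_xr small p.
  have dPi := is_derive_support_along s_total i small p.
  split; [exact: ex_derive|exact: ex_derive|].
  exists ((xr - xl) / (2 * phi%:num ^+ 2)).
    by rewrite divr_gt0 ?subr_gt0// mulr_gt0// exprn_gt0.
  rewrite !derive1E !derive_val -/xl -/xr -/l -/r -/(e p) -/E.
  by field.
have attract p : 0 < e p * ((r - l) * E) ->
    benefits_from_attracting p x s phi nu i.
  move=> h; have [dV dPi [c c0 cE]] := derivs p; split=> //.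
  by rewrite cE mulr_gt0.
have alienate p : e p * ((r - l) * E) < 0 ->
    benefits_from_alienating p x s phi nu i.
  move=> h; have [dV dPi [c c0 cE]] := derivs p; split=> //.
  by rewrite cE pmulr_rlt0.
(* [E] is regrouped around the opponent's platform: [xl] for [PartyA], [xr] for [PartyB]. The
   leftover terms are nonnegative because no weight exceeds 1. *)
have El : E = 2 * ((r - l) * (x i - xl) + (xr - xl) * (1 - r)) by rewrite /E; ring.
have Er : E = 2 * ((r - l) * (x i - xr) + (xr - xl) * (1 - l)) by rewrite /E; ring.
have Dl : 0 <= (xr - xl) * (1 - l) by rewrite mulr_ge0// subr_ge0// ltW.
have Dr : 0 <= (xr - xl) * (1 - r) by rewrite mulr_ge0// subr_ge0// ltW.
(* In all four cases [r - l] and the distance to the opponent's platform have the same sign, so [E]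
   is positive and the sign of [e p * (r - l)] decides. *)
split; split.
- rewrite gt_max => /andP[xli /l_lt_r lr]; apply: attract.
  rewrite mul1r pmulr_rgt0 ?subr_gt0// El pmulr_rgt0// ltr_pwDl//.
  by rewrite mulr_gt0 ?subr_gt0.
- rewrite lt_min => /andP[xli /r_lt_l rl]; apply: alienate.
  rewrite mul1r nmulr_rlt0 ?subr_lt0// El pmulr_rgt0// ltr_pwDl//.
  by rewrite nmulr_rgt0 ?subr_lt0.
- rewrite lt_min => /andP[xri /r_lt_l rl]; apply: attract.
  rewrite mulN1r oppr_gt0 nmulr_rlt0 ?subr_lt0// Er pmulr_rgt0// ltr_pwDl//.
  by rewrite nmulr_rgt0 ?subr_lt0.
- rewrite gt_max => /andP[xri /l_lt_r lr]; apply: alienate.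
  rewrite mulN1r oppr_lt0 pmulr_rgt0 ?subr_gt0// Er pmulr_rgt0// ltr_pwDl//.
  by rewrite mulr_gt0 ?subr_gt0.
Qed.
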